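(* For every simple signed graph $G$ with underlying unsigned graph $\underline{G}$ we have $\chi(G)\le\chi_a(\underline{G})$, where $\chi_a(\underline{G})$ denotes the acyclic chromatic number of $\underline{G}$.
   Context: All graphs are finite and nonempty. A signed graph $G$ is a graph in which each edge $e$ is labelled with a sign $\sigma(e)\in\{+1,-1\}$; its underlying unsigned graph, obtained by forgetting the signs, is denoted by $\underline{G}$, and $G$ is simple if $\underline{G}$ has no loops and no parallel edges. A proper colouring of $G$ is a mapping $\phi\colon V(G)\to\mathbb{Z}$ such that for each edge $e=uv$ of $G$ we have $\phi(u)\neq\sigma(e)\phi(v)$. For $n\ge1$ let $M_n=\{\pm1,\pm2,\ldots,\pm k\}$ if $n=2k$, and $M_n=\{0,\pm1,\pm2,\ldots,\pm k\}$ if $n=2k+1$. An $n$-colouring of $G$ is a proper colouring of $G$ using colours from $M_n$. The chromatic number $\chi(G)$ of a signed graph $G$ is the smallest $n\ge 1$ such that $G$ admits an $n$-colouring. An acyclic colouring of an unsigned graph $H$ is a proper vertex colouring of $H$ in the usual sense (each colour class is an independent set) such that the union of any two colour classes induces a forest; the acyclic chromatic number $\chi_a(H)$ is the minimum number of colours in an acyclic colouring of $H$. *)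

(* Defs.v *)
From HB Require Import structures.
From mathcomp Require Import all_boot all_order all_algebra.
From mathcomp Require Import boolp.

Set Implicit Arguments.
Unset Strict Implicit.
Unset Printing Implicit Defensive.

Import Order.TTheory GRing.Theory Num.Theory.

Record simple_graph := SimpleGraph {
  vertex :> finType;
  adj : rel vertex;
  adj_sym : symmetric adj;
  adj_irr : irreflexive adj;
  vertex_gt0 : 0 < #|vertex|
}.

(* The sign of the edge uv is [sign u v]; only its values on adjacent pairs
   are meaningful. *)
Record simple_signed_graph := SimpleSignedGraph {
  underlying : simple_graph;
  sign : underlying -> underlying -> int;
  sign_sym : forall u v : underlying, adj u v -> sign u v = sign v u;
  sign_val : forall u v : underlying,
    adj u v -> sign u v = 1%R \/ sign u v = (-1)%R
}.

Definition signed_proper (G : simple_signed_graph) (phi : underlying G -> int) : Prop :=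
  forall u v : underlying G, adj u v -> phi u <> (sign u v * phi v)%R.

(* {+-1, ..., +-k} for n = 2k, and {0, +-1, ..., +-k} for n = 2k + 1. *)
Definition colour_set (n : nat) : pred int :=
  [pred x : int | (absz x <= n./2) && (odd n || (x != 0%R))].

Definition signed_colourable (G : simple_signed_graph) (n : nat) : Prop :=
  exists phi : underlying G -> int,
    signed_proper phi /\ forall v, phi v \in colour_set n.

Lemma signed_colourable_ex (G : simple_signed_graph) :
  exists n, (1 <= n) && `[< signed_colourable G n >].
Proof.
exists (#|underlying G|).*2; apply/andP; split.
  by rewrite double_gt0 vertex_gt0.
apply/asboolP; exists (fun v => Posz (enum_rank v).+1); split=> [u v uv|v].
  case: (sign_val uv) => ->; rewrite ?mul1r ?mulN1r // => -[] /ord_inj.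
  by move/enum_rank_inj=> eq_uv; rewrite eq_uv adj_irr in uv.
by rewrite inE /= doubleK ltn_ord orbT.
Qed.

Definition chromatic_number (G : simple_signed_graph) : nat :=
  ex_minn (signed_colourable_ex G).

(* A cycle of a simple graph is a cyclic sequence of at least three distinct
   vertices, consecutive ones being adjacent. *)
Definition induces_forest (H : simple_graph) (A : {set H}) : Prop :=
  forall c : seq H, {subset c <= A} -> 3 <= size c -> ~ ucycle (@adj H) c.

Definition colour_class (H : simple_graph) (k : nat) (f : H -> 'I_k) (i : 'I_k) :
  {set H} := [set v | f v == i].

Definition proper_colouring (H : simple_graph) (k : nat) (f : H -> 'I_k) : Prop :=
  forall (i : 'I_k) (u v : H),
    u \in colour_class f i -> v \in colour_class f i -> ~~ adj u v.

Definition acyclic_colouring (H : simple_graph) (k : nat) (f : H -> 'I_k) : Prop :=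
  proper_colouring f /\
  forall i j : 'I_k, i != j ->
    induces_forest (colour_class f i :|: colour_class f j).

Definition acyclically_colourable (H : simple_graph) (k : nat) : Prop :=
  exists f : H -> 'I_k, acyclic_colouring f.

Lemma acyclically_colourable_ex (H : simple_graph) :
  exists k, `[< acyclically_colourable H k >].
Proof.
exists #|H|; apply/asboolP; exists enum_rank; split=> [i u v|i j _ c cA c3].
  by rewrite !inE => /eqP <- /eqP /enum_rank_inj ->; rewrite adj_irr.
case/andP=> _ c_uniq.
have: size c <= 2.
  apply: (leq_trans (uniq_leq_size c_uniq (s2 := [:: enum_val i; enum_val j]) _)) => //.
  move=> x /cA; rewrite !inE => /orP[] /eqP <-;
    by rewrite enum_rankK eqxx ?orbT.
by rewrite leqNgt c3.
Qed.

Definition acyclic_chromatic_number (H : simple_graph) : nat :=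
  ex_minn (acyclically_colourable_ex H).

(* Main.v *)
(** Pair up the classes of an acyclic [k]-colouring. Each pair induces a forest,
    and a signed forest can be properly coloured with [{c, -c}] for any [c > 0]:
    strip off a vertex of degree at most one, colour the rest, and choose the sign
    at the stripped vertex. Distinct pairs get distinct absolute values, and when
    [k] is odd the unpaired class, which is independent, gets the colour [0]. *)

Require Import Defs.
From mathcomp Require Import all_boot all_order all_algebra.
From mathcomp Require Import boolp zify.

Set Implicit Arguments.
Unset Strict Implicit.
Unset Printing Implicit Defensive.

Import GRing.Theory.

(** If no cycle exists, a simple path in [A] can always be extended at its head, and so would
    outgrow the finite type [T]. *)
Lemma exists_ucycle_of_two_neighbours (T : finType) (e : rel T) (A : {set T}) (a : T) :
  symmetric e -> irreflexive e -> a \in A ->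
  (forall x, x \in A -> exists y z,
     [/\ y \in A, z \in A, e x y, e x z & y != z]) ->
  exists c, [/\ {subset c <= A}, 3 <= size c & ucycle e c].
Proof.
move=> e_sym e_irr aA deg2; apply: contrapT => no_cycle.
have long_path n : exists x p,
    [/\ {subset x :: p <= A}, path e x p, uniq (x :: p) & size p = n].
  elim: n => [|n [x [p [pA e_p p_uniq <-]]]].
    by exists a, [::]; split=> // x; rewrite inE => /eqP ->.
  have [y [yA exy y_head]] : exists y, [/\ y \in A, e x y & y != head x p].
    have [y [z [yA zA exy exz yz]]] := deg2 x (pA x (mem_head x p)).
    have [yh|] := eqVneq y (head x p); last by exists y.
    by exists z; rewrite -yh eq_sym.
  have [y_p|y_p] := boolP (y \in p); last first.
    exists y, (x :: p); split=> //=.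
    - by move=> z; rewrite inE => /predU1P[->|/pA].
    - by rewrite e_sym exy.
    - rewrite inE negb_or y_p andbT; apply/andP; split=> //.
      by apply: contraTneq exy => ->; rewrite e_irr.
  (* The path from [x] to [y] closes up through the edge [y x]; since [y] is not the successor of
     [x], at least three vertices lie on it. *)
  case: no_cycle; case/splitPr: y_p pA e_p p_uniq y_head => p1 p2 pA e_p p_uniq y_head.
  exists (x :: rcons p1 y); split.
  - move=> z z_c; apply: pA; move: z_c.
    by rewrite !inE mem_rcons mem_cat !inE => /or3P[]->; rewrite ?orbT.
  - by case: p1 y_head {pA e_p p_uniq} => [|z p1 _] /=; rewrite ?eqxx // size_rcons.
  - move: e_p p_uniq; rewrite -cat_rcons cat_path -cat_cons cat_uniq.
    case/andP=> e_p _ /andP[p_uniq _].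
    by rewrite /ucycle p_uniq andbT /= rcons_path e_p last_rcons e_sym.
have [x [p [_ _ p_uniq p_size]]] := long_path #|T|.
by have := max_card [in x :: p]; rewrite (card_uniqP p_uniq) /= p_size ltnn.
Qed.

(** Only cycles could make the parity constraints inconsistent. The bit [g] will serve as the sign
    of a colour, and [s] will mark the edges whose ends need opposite signs. *)
Lemma forest_parity_potential (H : simple_graph) (s : H -> H -> bool) (A : {set H}) :
  (forall u v, adj u v -> s u v = s v u) -> induces_forest A ->
  exists g : H -> bool,
    forall u v, u \in A -> v \in A -> adj u v -> g u = g v (+) s u v.
Proof.
move=> s_sym; have [n] := ubnP #|A|; elim: n A => // n IHn A leAn forestA.
have [->|[a aA]] := set_0Vmem A; first by exists xpred0 => u v; rewrite inE.
(* Degree at most one inside [A], so isolated vertices count as leaves. *)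
have [x xA leaf_x] : exists2 x, x \in A &
    forall y z, y \in A -> z \in A -> adj x y -> adj x z -> y = z.
  apply: contrapT => no_leaf.
  case: (@exists_ucycle_of_two_neighbours H (@adj H) A a) => //.
  - exact: adj_sym.
  - exact: adj_irr.
  - move=> x xA; apply: contrapT => deg1; apply: no_leaf; exists x => // y z yA zA xy xz.
    by apply: contrapT => /eqP yz; apply: deg1; exists y, z.
  - by move=> c [cA c3 c_cycle]; apply: (forestA c).
have [||g gP] := IHn (A :\ x).
- by move: leAn; rewrite (cardsD1 x A) xA.
- by move=> c cA; apply: forestA => y /cA /setD1P[].
(* The only neighbour left, if any, forces the value at [x]; otherwise [false] is arbitrary. *)
pose gx := if [pick y in A | adj x y] is Some y then g y (+) s x y else false.
have gxP y : y \in A -> adj x y -> gx = g y (+) s x y.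
  move=> yA xy; rewrite /gx; case: pickP => [z /andP[zA xz]|/(_ y)].
    by rewrite (leaf_x _ _ yA zA xy xz).
  by rewrite yA xy.
exists (fun v => if v == x then gx else g v) => u v uA vA uv.
have [ux|ux] := eqVneq u x; have [vx|vx] := eqVneq v x.
- by rewrite ux vx adj_irr in uv.
- by rewrite ux (gxP v) // -ux.
- by rewrite (gxP u) // -?vx ?[adj v u]adj_sym // (s_sym u v uv) addbK.
- by apply: gP => //; apply/setD1P.
Qed.

Lemma signed_colourable_of_acyclically_colourable (G : simple_signed_graph) (k : nat) :
  acyclically_colourable (underlying G) k -> signed_colourable G k.
Proof.
case=> f [f_proper f_forest].
(* Classes [2m] and [2m+1] form pair [m]; only the last class of an odd [k] has [h v = k./2]. *)
pose h v := (f v)./2.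
pose s (u v : underlying G) := sign u v == 1%R.
have s_sym u v : adj u v -> s u v = s v u by move=> uv; rewrite /s sign_sym.
(* The bound sits under the existential so that [choice] gives one [g] for all [m]. *)
have pair_potential m : exists g : underlying G -> bool, m < k./2 ->
    forall u v, h u = m -> h v = m -> adj u v -> g u = g v (+) s u v.
  have [mk|] := boolP (m < k./2); last by exists xpred0.
  have ik : m.*2 < k by lia.
  have jk : m.*2.+1 < k by lia.
  have ij : Ordinal ik != Ordinal jk by rewrite -val_eqE /=; lia.
  have [g gP] := forest_parity_potential s_sym (f_forest _ _ ij).
  have in_pair v : h v = m ->
      v \in colour_class f (Ordinal ik) :|: colour_class f (Ordinal jk).
    by rewrite /h !inE -!val_eqE /=; lia.
  by exists g => _ u v /in_pair uA /in_pair vA; apply: gP.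
have [g gP] := choice pair_potential.
(* The shift to [(h v).+1] keeps paired colours nonzero, hence distinct from their negatives and
   from the colour of the unpaired class. *)
pose phi v : int :=
  if h v < k./2 then ((-1) ^+ g (h v) v * (h v).+1%:Z)%R else 0%R.
have abs_phi v : absz (phi v) = if h v < k./2 then (h v).+1 else 0.
  by rewrite /phi; case: ifP => // _; rewrite abszMsign.
exists phi; split=> [u v uv phi_uv|v]; last first.
  rewrite inE /= -absz_eq0 abs_phi; have := ltn_ord (f v); rewrite /h.
  case: ifP => /=; first by rewrite orbT andbT.
  by rewrite orbF; have := odd_double_half k; case: (odd k) => /=; lia.
(* A conflict forces equal absolute values, so both ends lie in the same pair or both in the
   unpaired class. *)
have abs_uv : absz (phi u) = absz (phi v).
  by rewrite phi_uv abszM; case: (sign_val uv) => ->; rewrite mul1n.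
have fu := ltn_ord (f u); have fv := ltn_ord (f v).
have [hu|hu] := boolP (h u < k./2); last first.
  have hv : (h v < k./2) = false.
    by move: abs_uv; rewrite !abs_phi (negPf hu); case: ifP.
  have fuv : f v = f u by apply: ord_inj; move: hu hv; rewrite /h; lia.
  by have := f_proper (f u) u v; rewrite !inE fuv eqxx uv => /(_ isT isT).
have huv : h v = h u by move: abs_uv; rewrite !abs_phi hu; case: ifP => // _ [].
move: phi_uv; rewrite /phi huv hu (gP _ hu u v) // /s.
by case: (sign_val uv) => ->; case: (g _ v) => /=; lia.
Qed.

Theorem proposition2p5 (G : simple_signed_graph) :
  chromatic_number G <= acyclic_chromatic_number (underlying G).
Proof.
rewrite /acyclic_chromatic_number; case: ex_minnP => k /asboolP k_col _.
rewrite /chromatic_number; case: ex_minnP => n _; apply; apply/andP; split.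
  (* A vertex exists and has a colour in ['I_k], so [k] is positive. *)
  have [v _] := card_gt0P (vertex_gt0 (underlying G)).
  by case: k_col => f _; apply: leq_ltn_trans (ltn_ord (f v)).
exact/asboolP/signed_colourable_of_acyclically_colourable.
Qed.
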